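(* Assume that there are constants $A,B,\ell>0$ and a function $h$ such that $\mathcal{K}(r)=A+Br^{\ell}+h(r)$ and $\lim_{r\to 0}\frac{|h(r)|+r|h'(r)|}{r^{\ell}}=0$. Define $\tilde R(d)=R(d)$ if $d\in J$ and $\tilde R(d)=+\infty$ if $d\notin J$. If $\ell\ge\ell_p^*=\frac{n-p}{p-1}$, then there is $\mathcal{R}_0>0$ such that $\tilde R(d)\ge\mathcal{R}_0$ for any $d\ge 0$.
   Context: Standing assumptions: $n$ is a positive integer, $p$ is real with $1<p<n$ and $\frac{2n}{n+2}\le p\le 2$, $q=\frac{np}{n-p}$, and $\mathcal{K}:[0,+\infty)\to(0,+\infty)$ is $C^1$. For each $d>0$, $u(r;d)$ denotes the unique (regular) solution of $(r^{n-1}u'|u'|^{p-2})'+r^{n-1}\mathcal{K}(r)u|u|^{q-2}=0$ with $\lim_{r\to0}u(r;d)=d$ (it satisfies $u'(0;d)=0$). $J$ is the set of $d>0$ such that $u(\cdot;d)$ is a crossing solution, i.e. has a zero at some finite positive $r$, and for $d\in J$, $R(d)>0$ denotes the first zero of $u(\cdot;d)$. In particular $0\notin J$. *)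

(* Defs.v *)
(* Stdlib real numbers with Coquelicot. *)
From Stdlib Require Import Reals ClassicalEpsilon.
From Coquelicot Require Import Coquelicot.
Open Scope R_scope.

(* x^a for x >= 0, a > 0; [Rpower 0 a] is 1, not 0. *)
Definition pow0 (x a : R) : R := if Req_EM_T x 0 then 0 else Rpower x a.

(* x|x|^(a-2), equal to 0 at x = 0 for every a since [Rpower 0 _] is finite:
   this is the continuous extension whenever a > 1. *)
Definition spow (a x : R) : R := x * Rpower (Rabs x) (a - 2).

(* C^1 on the closed half-line: the derivative at 0 and its continuity there
   are one-sided, so values of K on the negative axis play no role. *)
Definition C1_halfline (K : R -> R) : Prop :=
  exists dK : R -> R, forall r, 0 <= r ->
    D_in K dK (fun s => 0 <= s) r /\ continue_in dK (fun s => 0 <= s) r.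

Definition flux (n : nat) (p : R) (u : R -> R) (r : R) : R :=
  r ^ (n - 1) * spow p (Derive u r).

(* Solutions are global on (0, +oo) and may change sign.  Continuity of u' on
   (0, +oo) and u'(0) = 0 are consequences when 1 < p < n. *)
Definition regular_solution (n : nat) (p q : R) (K : R -> R) (d : R)
    (u : R -> R) : Prop :=
  (forall r, 0 < r ->
     ex_derive u r /\ ex_derive (flux n p u) r /\
     Derive (flux n p u) r + r ^ (n - 1) * K r * spow q (u r) = 0) /\
  filterlim u (at_right 0) (locally d).

(* [u] maps an initial value d to the solution u(.;d); 0 is never in J. *)
Definition J (u : R -> R -> R) (d : R) : Prop :=
  0 < d /\ exists r, 0 < r /\ u d r = 0.

Definition is_first_zero (f : R -> R) (r : R) : Prop :=
  0 < r /\ f r = 0 /\ forall s, 0 < s < r -> f s <> 0.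

Definition first_zero (f : R -> R) : R := epsilon (inhabits 0) (is_first_zero f).

Definition Rtilde (u : R -> R -> R) (d : R) : Rbar :=
  if excluded_middle_informative (J u d) then Finite (first_zero (u d))
  else p_infty.

(* Main.v *)
Require Import Defs.
From Stdlib Require Import Reals Lra Lia ClassicalEpsilon Ranalysis5.
From Coquelicot Require Import Coquelicot.
Open Scope R_scope.

(* Let M = r^(n-1) |u'|^(p-1) be the negated flux, s = (n-p)/(p-1), R the first
   zero of u and N = M(R)^(1/(p-1)).  On (0, R) the function M increases and
   |u'| = M^(1/(p-1)) r^(-s-1), so u <= (N/s) r^(-s).  Up to a multiple of N, the
   derivative r^n K' u^q / q of the Pohozaev function P is then bounded, as
   ell >= s, by r^(n-1) K u^(q-1) = M'.  Hence P(R) <= c N M(R) with c independent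
   of d, whereas P(R) = (p-1)/p N M(R) R^(-s): this bounds R from below.  The
   vanishing of P at 0 is only needed along a sequence, on which r u' -> 0. *)

(** * Derivatives of real powers, monotonicity, right limits at 0 *)

Lemma Rpower_gt0 (x a : R) : 0 < Rpower x a.
Proof. apply exp_pos. Qed.

Lemma is_derive_Rpower (f : R -> R) (a x l : R) :
  0 < f x -> is_derive f x l ->
  is_derive (fun t => Rpower (f t) a) x (a * Rpower (f x) (a - 1) * l).
Proof.
  intros Hx Hf.
  assert (E : Rpower (f x) a = f x * Rpower (f x) (a - 1)).
  { rewrite <- (Rpower_1 (f x)) at 2 by assumption.
    rewrite <- Rpower_plus. f_equal. lra. }
  unfold Rpower at 1.
  auto_derive.
  - split; [now exists l | split; auto].
  - change (Derive (fun t => f t) x) with (Derive f x).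
    rewrite (is_derive_unique _ _ _ Hf).
    change (exp (a * ln (f x))) with (Rpower (f x) a). rewrite E. field. lra.
Qed.

Lemma derive_nonpos_le (f f' : R -> R) (a b : R) :
  a <= b -> (forall c, a <= c <= b -> is_derive f c (f' c)) ->
  (forall c, a < c < b -> f' c <= 0) -> f b <= f a.
Proof.
  intros Hab Hd Hn. destruct Hab as [Hab | <-]; [|lra].
  destruct (MVT_cor2 f f' a b Hab) as [c [Hc Hc']].
  { intros c Hc. apply is_derive_Reals, Hd, Hc. }
  specialize (Hn c Hc'). nra.
Qed.

Lemma derive_pos_lt (f f' : R -> R) (a b : R) :
  a < b -> (forall c, a <= c <= b -> is_derive f c (f' c)) ->
  (forall c, a < c < b -> 0 < f' c) -> f a < f b.
Proof.
  intros Hab Hd Hn.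
  destruct (MVT_cor2 f f' a b Hab) as [c [Hc Hc']].
  { intros c Hc. apply is_derive_Reals, Hd, Hc. }
  specialize (Hn c Hc'). nra.
Qed.

Lemma at_right_0_elim (P : R -> Prop) :
  at_right 0 P -> exists e, 0 < e /\ forall x, 0 < x < e -> P x.
Proof.
  intros [e He]. exists e. split; [apply cond_pos|]. intros x Hx.
  apply He; [|lra]. unfold ball; simpl; unfold AbsRing_ball, abs, minus, plus, opp; simpl.
  apply Rabs_def1; lra.
Qed.

Lemma filterlim_at_right_0 (f : R -> R) (l eps : R) :
  filterlim f (at_right 0) (locally l) -> 0 < eps ->
  exists e, 0 < e /\ forall x, 0 < x < e -> Rabs (f x - l) < eps.
Proof.
  intros Hf He. apply at_right_0_elim.
  apply (Hf (fun y => Rabs (y - l) < eps)).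
  exists (mkposreal eps He). intros y Hy. exact Hy.
Qed.

(** * First zeros, and behaviour near 0, of functions with a right limit at 0 *)

(** Gives [epsilon] in [first_zero] a genuine witness. The zero is the supremum [m] of the [x] with
    no zero on (0, x]: this set is nonempty because [f] stays within [d] of [d > 0] near 0, and if
    [f m] were nonzero, continuity would extend the zero-free interval beyond [m]. *)
Lemma exists_first_zero (f : R -> R) (d : R) :
  0 < d -> (forall r, 0 < r -> continuous f r) ->
  filterlim f (at_right 0) (locally d) ->
  (exists r, 0 < r /\ f r = 0) -> exists r, is_first_zero f r.
Proof.
  intros Hd Hc Hl [r [Hr Hr0]].
  destruct (filterlim_at_right_0 f d d Hl Hd) as [e [He Hne]].
  set (E := fun x => 0 < x /\ forall s, 0 < s <= x -> f s <> 0).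
  assert (Hb : is_upper_bound E r).
  { intros x [Hx Hx']. apply Rnot_lt_le. intros Hlt. apply (Hx' r); [lra|assumption]. }
  assert (HE : E (e / 2)).
  { split; [lra|]. intros s Hs H0. specialize (Hne s ltac:(lra)).
    rewrite H0 in Hne. apply Rabs_def2 in Hne. lra. }
  destruct (completeness E) as [m [Hm1 Hm2]]; [now exists r|now exists (e / 2)|].
  assert (Hm : 0 < m) by (specialize (Hm1 _ HE); lra).
  assert (Hbelow : forall s, 0 < s < m -> f s <> 0).
  { intros s Hs H0. assert (m <= s); [|lra]. apply Hm2. intros x [Hx Hx'].
    apply Rnot_lt_le. intros Hlt. apply (Hx' s); [lra|assumption]. }
  exists m. split; [assumption|split; [|assumption]].
  destruct (Req_dec (f m) 0) as [H0|H0]; [assumption|exfalso].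
  assert (Hp : 0 < Rabs (f m)) by now apply Rabs_pos_lt.
  destruct (proj1 (filterlim_locally _ _) (Hc m Hm) (mkposreal _ Hp)) as [del Hdel].
  assert (Hdel0 := cond_pos del).
  assert (HE' : E (m + del / 2)).
  { split; [lra|]. intros s Hs Hs0.
    destruct (Rlt_le_dec s m) as [Hsm|Hsm]; [apply (Hbelow s); [lra|assumption]|].
    assert (Hb' : ball (f m) (Rabs (f m)) (f s)).
    { apply Hdel. apply Rabs_def1; unfold minus, plus, opp; simpl; lra. }
    rewrite Hs0 in Hb'. unfold ball in Hb'; simpl in Hb'.
    unfold AbsRing_ball, abs, minus, plus, opp in Hb'; simpl in Hb'.
    rewrite Rplus_0_l, Rabs_Ropp in Hb'. lra. }
  specialize (Hm1 _ HE'). lra.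
Qed.

(** A negative value at [r] would, by the intermediate value theorem, force a zero between [r] and a
    point close to 0, where [f] is near [d > 0]. *)
Lemma pos_before_first_zero (f : R -> R) (d rho r : R) :
  0 < d -> (forall r, 0 < r -> continuous f r) ->
  filterlim f (at_right 0) (locally d) ->
  is_first_zero f rho -> 0 < r < rho -> 0 < f r.
Proof.
  intros Hd Hc Hl [_ [_ Hn]] Hr.
  destruct (filterlim_at_right_0 f d d Hl Hd) as [e [He Hne]].
  destruct (Rtotal_order (f r) 0) as [H|[H|H]]; [|now elim (Hn r Hr)|exact H].
  set (x := Rmin e r / 2).
  assert (Hx : 0 < x /\ x < e /\ x < r).
  { unfold x. generalize (Rmin_l e r), (Rmin_r e r), (Rmin_pos e r He (proj1 Hr)). lra. }
  specialize (Hne x ltac:(lra)). apply Rabs_def2 in Hne.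
  destruct (IVT_interv (fun t => - f t) x r) as [z [Hz Hz0]]; [|lra..|].
  { intros y Hy. apply continuity_pt_opp, continuity_pt_filterlim, Hc. lra. }
  elim (Hn z); lra.
Qed.

(* The mean value theorem on [r, 2r] produces the point. *)
Lemma small_scaled_derivative (u : R -> R) (d eps : R) :
  (forall r, 0 < r -> ex_derive u r) ->
  filterlim u (at_right 0) (locally d) -> 0 < eps ->
  exists x, 0 < x < eps /\ x * Rabs (Derive u x) < eps.
Proof.
  intros Hu Hl He.
  (* With tolerance [eps / 4] the increment of [u] over [r, 2r] is below [eps / 2]; hence r |u' x| <
     eps / 2, and x < 2r costs the remaining factor 2. *)
  destruct (filterlim_at_right_0 u d (eps / 4) Hl ltac:(lra)) as [e [He0 Hne]].
  set (r := Rmin e eps / 3).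
  assert (Hr : 0 < r /\ 2 * r < e /\ 2 * r < eps).
  { unfold r. generalize (Rmin_l e eps), (Rmin_r e eps), (Rmin_pos e eps He0 He). lra. }
  destruct (MVT_cor2 u (Derive u) r (2 * r)) as [x [Hx Hx']]; [lra| |].
  { intros c Hc. apply is_derive_Reals, Derive_correct, Hu. lra. }
  exists x. split; [lra|].
  assert (H1 := Hne r ltac:(lra)). assert (H2 := Hne (2 * r) ltac:(lra)).
  apply Rabs_def2 in H1. apply Rabs_def2 in H2.
  assert (Rabs (Derive u x) * r < eps / 2).
  { rewrite <- (Rabs_pos_eq r) at 1 by lra. rewrite <- Rabs_mult.
    replace (2 * r - r) with r in Hx by ring. rewrite <- Hx. apply Rabs_def1; lra. }
  assert (0 <= Rabs (Derive u x)) by apply Rabs_pos. nra.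
Qed.

(** * The flux expressed through real powers *)

Lemma pow_minus_1_Rpower (n : nat) (r : R) :
  (0 < n)%nat -> 0 < r -> r ^ (n - 1) = Rpower r (INR n - 1).
Proof.
  intros Hn Hr. rewrite <- Rpower_pow by assumption. f_equal.
  rewrite minus_INR by lia. reflexivity.
Qed.

Lemma spow_pos (a x : R) : 0 < x -> spow a x = Rpower x (a - 1).
Proof.
  intros Hx. unfold spow. rewrite Rabs_pos_eq by lra.
  rewrite <- (Rpower_1 x) at 1 by assumption. rewrite <- Rpower_plus. f_equal. ring.
Qed.

Lemma spow_opp (a x : R) : spow a (- x) = - spow a x.
Proof. unfold spow. rewrite Rabs_Ropp. ring. Qed.

Lemma spow_0 (a : R) : spow a 0 = 0.
Proof. unfold spow. ring. Qed.

(** Inverts the flux: a negative flux forces u' < 0, and then the root of order p - 1 of r^(n-1)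
    |u'|^(p-1) is r^((n-1)/(p-1)) |u'|, where (n-1)/(p-1) = (n-p)/(p-1) + 1. *)
Lemma Derive_of_neg_flux (n : nat) (p : R) (u : R -> R) (r : R) :
  (0 < n)%nat -> 1 < p -> 0 < r -> flux n p u r < 0 ->
  Derive u r = - (Rpower (- flux n p u r) (/ (p - 1)) *
                  Rpower r (- ((INR n - p) / (p - 1)) - 1)).
Proof.
  intros Hn Hp Hr Hf. unfold flux in *. set (v := Derive u r) in *.
  rewrite pow_minus_1_Rpower in * by assumption.
  assert (Hr' := Rpower_gt0 r (INR n - 1)).
  assert (Hv : 0 < - v).
  { apply Rnot_le_lt. intros Hv.
    assert (0 <= spow p v); [|nra].
    unfold spow. apply Rmult_le_pos; [lra|left; apply Rpower_gt0]. }
  replace v with (- - v) at 2 by ring. rewrite spow_opp, spow_pos by assumption.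
  replace (- (Rpower r (INR n - 1) * - Rpower (- v) (p - 1)))
    with (Rpower r (INR n - 1) * Rpower (- v) (p - 1)) by ring.
  rewrite <- Rpower_mult_distr, !Rpower_mult by (assumption || apply Rpower_gt0).
  replace ((p - 1) * / (p - 1)) with 1 by (field; lra).
  rewrite Rpower_1 by assumption.
  replace (_ * Rpower r _) with
    (- v * (Rpower r ((INR n - 1) * / (p - 1)) *
            Rpower r (- ((INR n - p) / (p - 1)) - 1))) by ring.
  rewrite <- Rpower_plus.
  replace (_ + _) with 0 by (field; lra).
  rewrite Rpower_O by assumption. ring.
Qed.

(** Comes from |flux| = r^(n-p) (r |u'|)^(p-1). As p < n, it makes the flux vanish along a sequence
    tending to 0 on which r u' is small. *)
Lemma Rabs_flux_le (n : nat) (p : R) (u : R -> R) (r : R) :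
  (0 < n)%nat -> 1 < p -> 0 < r -> r * Rabs (Derive u r) <= 1 ->
  Rabs (flux n p u r) <= Rpower r (INR n - p).
Proof.
  intros Hn Hp Hr Hv. unfold flux. set (v := Derive u r) in *.
  rewrite pow_minus_1_Rpower by assumption.
  (* The case v = 0 is separate because [Rpower 0 (p - 1)] is 1, whereas the flux is 0. *)
  destruct (Req_dec v 0) as [-> | H0].
  { rewrite spow_0, Rmult_0_r, Rabs_R0. left. apply Rpower_gt0. }
  apply Rabs_pos_lt in H0.
  rewrite Rabs_mult, (Rabs_pos_eq (Rpower _ _)) by (left; apply Rpower_gt0).
  replace (Rabs (spow p v)) with (Rpower (Rabs v) (p - 1)).
  2:{ rewrite <- spow_pos by assumption. unfold spow.
      rewrite Rabs_Rabsolu, Rabs_mult. f_equal.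
      symmetry. apply Rabs_pos_eq. left. apply Rpower_gt0. }
  replace (INR n - 1) with ((INR n - p) + (p - 1)) by ring.
  rewrite Rpower_plus, Rmult_assoc, Rpower_mult_distr by assumption.
  rewrite <- (Rmult_1_r (Rpower r (INR n - p))) at 2.
  apply Rmult_le_compat_l; [left; apply Rpower_gt0|].
  replace 1 with (Rpower 1 (p - 1)) at 2
    by (unfold Rpower; now rewrite ln_1, Rmult_0_r, exp_0).
  apply Rle_Rpower_l; [lra|split; [nra|assumption]].
Qed.

Lemma small_Rpower (a eps : R) :
  0 < a -> 0 < eps -> exists e, 0 < e /\ forall x, 0 < x < e -> Rpower x a < eps.
Proof.
  intros Ha He. exists (Rpower eps (/ a)). split; [apply Rpower_gt0|].
  intros x Hx. rewrite <- (Rpower_1 eps) by assumption.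
  replace 1 with (/ a * a) by (field; lra). rewrite <- Rpower_mult.
  now apply Rlt_Rpower_l.
Qed.

(** * Pohozaev's identity and the resulting bound at a zero *)

(* Pohozaev's identity, with u' and the second derivative eliminated through the
   flux M = r^(m-1) |u'|^(p-1), which makes every term differentiable. *)
Lemma pohozaev_derive (m p q s : R) (K u M : R -> R) (r dK : R) :
  1 < p < m -> q = m * p / (m - p) -> s = (m - p) / (p - 1) ->
  0 < r -> 0 < u r -> 0 < M r ->
  is_derive K r dK ->
  is_derive u r (- (Rpower (M r) (/ (p - 1)) * Rpower r (- s - 1))) ->
  is_derive M r (Rpower r (m - 1) * K r * Rpower (u r) (q - 1)) ->
  is_derive (fun t => (p - 1) / p * (Rpower (M t) (p / (p - 1)) * Rpower t (- s))
                      + Rpower t m * K t * Rpower (u t) q / q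
                      - (m - p) / p * (u t * M t)) r
    (Rpower r m * dK * Rpower (u r) q / q).
Proof.
  intros Hp Hq Hs Hr Hu HM HdK Hdu HdM.
  assert (Hq0 : q <> 0).
  { rewrite Hq. apply Rgt_not_eq, Rdiv_lt_0_compat; nra. }
  assert (D1 := is_derive_Rpower M (p / (p - 1)) r _ HM HdM).
  assert (D2 := is_derive_Rpower (fun t => t) (- s) r _ Hr (is_derive_id r)).
  assert (D3 := is_derive_Rpower (fun t => t) m r _ Hr (is_derive_id r)).
  assert (D4 := is_derive_Rpower u q r _ Hu Hdu).
  simpl in D2, D3.
  set (f1 := fun t => Rpower (M t) (p / (p - 1))) in *.
  set (f2 := fun t => Rpower t (- s)) in *.
  set (f3 := fun t => Rpower t m) in *.
  set (f4 := fun t => Rpower (u t) q) in *.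
  apply (is_derive_ext (fun t => (p - 1) / p * (f1 t * f2 t) + f3 t * K t * f4 t / q
                                 - (m - p) / p * (u t * M t))); [reflexivity|].
  evar_last.
  { auto_derive.
    - repeat split; try (now eexists; eassumption).
    - reflexivity. }
  change (Derive (fun t => f1 t) r) with (Derive f1 r).
  change (Derive (fun t => f2 t) r) with (Derive f2 r).
  change (Derive (fun t => f3 t) r) with (Derive f3 r).
  change (Derive (fun t => f4 t) r) with (Derive f4 r).
  change (Derive (fun t => K t) r) with (Derive K r).
  change (Derive (fun t => u t) r) with (Derive u r).
  change (Derive (fun t => M t) r) with (Derive M r).
  rewrite (is_derive_unique f1 r _ D1), (is_derive_unique f2 r _ D2),
    (is_derive_unique f3 r _ D3), (is_derive_unique f4 r _ D4),
    (is_derive_unique _ _ _ HdK), (is_derive_unique _ _ _ Hdu),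
    (is_derive_unique _ _ _ HdM).
  unfold f1, f2, f3, f4, one; simpl.
  (* All powers are reduced to the four atoms [x], [y], [w], [z] times [r], [u r] or [M r]. The
     claim becomes a rational identity, in which the values of [s] and [q] cancel every term without
     [dK]. *)
  set (x := Rpower r (- s - 1)). set (y := Rpower r (m - 1)).
  set (w := Rpower (u r) (q - 1)). set (z := Rpower (M r) (/ (p - 1))).
  assert (E1 : Rpower (M r) (p / (p - 1)) = M r * z).
  { unfold z. rewrite <- (Rpower_1 (M r)) at 2 by assumption.
    rewrite <- Rpower_plus. f_equal. field. lra. }
  assert (E2 : Rpower (M r) (p / (p - 1) - 1) = z).
  { unfold z. f_equal. field. lra. }
  assert (E3 : Rpower r (- s) = r * x).
  { unfold x. rewrite <- (Rpower_1 r) at 2 by assumption.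
    rewrite <- Rpower_plus. f_equal. ring. }
  assert (E4 : Rpower r m = r * y).
  { unfold y. rewrite <- (Rpower_1 r) at 2 by assumption.
    rewrite <- Rpower_plus. f_equal. ring. }
  assert (E5 : Rpower (u r) q = u r * w).
  { unfold w. rewrite <- (Rpower_1 (u r)) at 2 by assumption.
    rewrite <- Rpower_plus. f_equal. ring. }
  rewrite E1, E2, E3, E4, E5.
  rewrite Hs, Hq. field. lra.
Qed.

Lemma continuous_left_le (f : R -> R) (a c : R) :
  0 < a -> continuous f a -> (forall r, 0 < r < a -> f r <= c) -> f a <= c.
Proof.
  intros Ha Hf Hle. apply Rnot_lt_le. intros Hlt.
  assert (Hp : 0 < f a - c) by lra.
  destruct (proj1 (filterlim_locally _ _) Hf (mkposreal _ Hp)) as [del Hdel].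
  assert (Hdel0 := cond_pos del).
  set (r := Rmax (a / 2) (a - del / 2)).
  assert (Hr : 0 < r /\ a - del < r < a).
  { generalize (Rmax_l (a / 2) (a - del / 2)), (Rmax_r (a / 2) (a - del / 2)).
    fold r. intros. assert (r < a) by (apply Rmax_lub_lt; lra). lra. }
  assert (Hb : ball (f a) (f a - c) (f r)).
  { apply Hdel. apply Rabs_def1; unfold minus, plus, opp; simpl; lra. }
  unfold ball in Hb; simpl in Hb.
  unfold AbsRing_ball, abs, minus, plus, opp in Hb; simpl in Hb.
  apply Rabs_def2 in Hb. specialize (Hle r ltac:(lra)). lra.
Qed.

(* Integrate u' >= -N t^(-s-1) from r to the zero rho of u. *)
Lemma decay_bound (s N rho : R) (u u' : R -> R) :
  0 < s -> 0 < rho -> 0 <= N -> u rho = 0 ->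
  (forall r, 0 < r <= rho -> is_derive u r (u' r) /\ - (N * Rpower r (- s - 1)) <= u' r) ->
  forall r, 0 < r <= rho -> s * (u r * Rpower r s) <= N.
Proof.
  intros Hs HR HN HuR Hu r Hr.
  assert (H : N / s * Rpower rho (- s) - u rho <= N / s * Rpower r (- s) - u r).
  { apply (derive_nonpos_le (fun t => N / s * Rpower t (- s) - u t)
             (fun t => - (N * Rpower t (- s - 1)) - u' t)); [lra| |].
    - intros c Hc. destruct (Hu c ltac:(lra)) as [Hu1 _].
      apply (is_derive_ext (fun t => minus (scal (N / s) (Rpower t (- s))) (u t))); [reflexivity|].
      evar_last.
      + apply (is_derive_minus (fun t => scal (N / s) (Rpower t (- s)))); [|exact Hu1].
        apply is_derive_scal, (is_derive_Rpower (fun t => t)); [lra|apply is_derive_id].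
      + unfold minus, plus, opp, scal, mult, one; simpl; unfold mult; simpl. field. lra.
    - intros c Hc. destruct (Hu c ltac:(lra)) as [_ Hu2]. lra. }
  rewrite HuR in H.
  assert (0 <= N / s * Rpower rho (- s)).
  { apply Rmult_le_pos; [now apply Rdiv_le_0_compat|left; apply Rpower_gt0]. }
  assert (Hle : u r <= N / s * Rpower r (- s)) by lra.
  assert (E : Rpower r (- s) * Rpower r s = 1).
  { rewrite <- Rpower_plus. replace (- s + s) with 0 by ring. now apply Rpower_O. }
  assert (Hp := Rpower_gt0 r s).
  apply (Rmult_le_compat_r (s * Rpower r s)) in Hle; [|nra].
  replace (N / s * Rpower r (- s) * (s * Rpower r s))
    with (N * (Rpower r (- s) * Rpower r s)) in Hle by (field; lra).
  rewrite E in Hle. lra.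
Qed.

(* Where r K' <= C r^s, the derivative r^m K' u^q / q of the Pohozaev function P
   is at most c N M' with N = M(rho)^(1/(p-1)), because u <= (N / s) r^(-s).
   So P <= c N M on (0, rho), and P ~ (p-1)/p N M rho^(-s) at rho. *)
Lemma zero_radius_bound (m p q s A A2 C rho d : R) (K dK u M : R -> R) :
  1 < p < m -> q = m * p / (m - p) -> s = (m - p) / (p - 1) ->
  0 < A -> 0 <= C -> 0 < rho <= 1 ->
  (forall r, 0 < r < rho ->
     is_derive K r (dK r) /\ A <= K r <= A2 /\ r * dK r <= C * Rpower r s) ->
  (forall r, 0 < r <= rho -> 0 < M r /\ M r <= M rho /\
     is_derive u r (- (Rpower (M r) (/ (p - 1)) * Rpower r (- s - 1)))) ->
  (forall r, 0 < r < rho -> 0 < u r /\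
     is_derive M r (Rpower r (m - 1) * K r * Rpower (u r) (q - 1))) ->
  ex_derive M rho -> u rho = 0 ->
  (exists e, 0 < e /\ forall r, 0 < r < e -> u r <= d) ->
  (forall eps, 0 < eps -> exists x, 0 < x < eps /\
     x * (Rpower (M x) (/ (p - 1)) * Rpower x (- s - 1)) < eps) ->
  Rpower rho (- s) <= C / (q * s * A) * (p / (p - 1)).
Proof.
  intros Hp Hq Hs HA HC HR HK Hu HM HMR HuR [e [He Hd]] Hx.
  assert (Hs0 : 0 < s) by (rewrite Hs; apply Rdiv_lt_0_compat; lra).
  assert (Hq0 : 0 < q) by (rewrite Hq; apply Rdiv_lt_0_compat; nra).
  set (a := / (p - 1)) in *.
  assert (Ha : 0 < a) by (apply Rinv_0_lt_compat; lra).
  set (N := Rpower (M rho) a).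
  assert (HN : 0 < N) by apply Rpower_gt0.
  assert (HMN : forall r, 0 < r <= rho -> Rpower (M r) a <= N).
  { intros r Hr. destruct (Hu r Hr) as [H1 [H2 _]]. apply Rle_Rpower_l; lra. }
  assert (Hdecay := decay_bound s N rho u
    (fun r => - (Rpower (M r) a * Rpower r (- s - 1))) Hs0 (proj1 HR) (Rlt_le _ _ HN) HuR).
  specialize (Hdecay ltac:(
    intros r Hr; split; [apply Hu, Hr|]; apply Ropp_le_contravar, Rmult_le_compat_r;
    [left; apply Rpower_gt0 | apply HMN, Hr])).
  (* Chosen so that the decay bound s u r^s <= N gives C r^s u / q <= c N A, and hence at most c N
     K. *)
  set (c := C / (q * s * A)).
  assert (Hc : c * (q * s * A) = C) by (unfold c; field; lra).
  assert (Hc0 : 0 <= c).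
  { apply Rdiv_le_0_compat; [assumption|]. apply Rmult_lt_0_compat; nra. }
  assert (EM : forall r, 0 < r <= rho ->
    Rpower (M r) (p / (p - 1)) = M r * Rpower (M r) a).
  { intros r Hr. destruct (Hu r Hr) as [H1 _].
    rewrite <- (Rpower_1 (M r)) at 2 by assumption.
    rewrite <- Rpower_plus. f_equal. unfold a. field. lra. }
  (* [G] is P - c N M. It is shown to be nonincreasing, then nonpositive by its behaviour near 0. *)
  set (G := fun t => ((p - 1) / p * (Rpower (M t) (p / (p - 1)) * Rpower t (- s))
                      + Rpower t m * K t * Rpower (u t) q / q
                      - (m - p) / p * (u t * M t)) - c * N * M t).
  set (G' := fun t => Rpower t m * dK t * Rpower (u t) q / q
                      - c * N * (Rpower t (m - 1) * K t * Rpower (u t) (q - 1))).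
  assert (HG : forall r, 0 < r < rho -> is_derive G r (G' r)).
  { intros r Hr. unfold G, G'.
    destruct (Hu r ltac:(lra)) as [H1 [_ H2]]. destruct (HM r Hr) as [H3 H4].
    apply (is_derive_minus (V := R_NormedModule) _ (fun t => c * N * M t)).
    - apply (pohozaev_derive m p q s); try assumption; [lra|apply HK, Hr].
    - apply (is_derive_scal M r (c * N)); assumption. }
  assert (HG' : forall r, 0 < r < rho -> G' r <= 0).
  { intros r Hr. unfold G'. destruct (HM r Hr) as [H3 _].
    destruct (HK r Hr) as [_ [H5 H6]]. assert (H7 := Hdecay r ltac:(lra)).
    assert (Em : Rpower r m = r * Rpower r (m - 1)).
    { rewrite <- (Rpower_1 r) at 2 by lra. rewrite <- Rpower_plus. f_equal. ring. }
    assert (Eq : Rpower (u r) q = u r * Rpower (u r) (q - 1)).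
    { rewrite <- (Rpower_1 (u r)) at 2 by assumption. rewrite <- Rpower_plus. f_equal. ring. }
    rewrite Em, Eq.
    assert (H8 : r * dK r * u r / q <= c * N * K r).
    { apply Rle_trans with (C * Rpower r s * u r / q).
      - apply Rmult_le_compat_r; [left; now apply Rinv_0_lt_compat|].
        apply Rmult_le_compat_r; lra.
      - apply Rle_trans with (c * N * A).
        + rewrite <- Hc.
          replace (c * (q * s * A) * Rpower r s * u r / q)
            with (c * A * (s * (u r * Rpower r s))) by (field; lra).
          replace (c * N * A) with (c * A * N) by ring.
          apply Rmult_le_compat_l; nra.
        + apply Rmult_le_compat_l; nra. }
    assert (H9 := Rmult_lt_0_compat _ _ (Rpower_gt0 r (m - 1)) (Rpower_gt0 (u r) (q - 1))).
    apply (Rmult_le_compat_l _ _ _ (Rlt_le _ _ H9)) in H8. unfold Rdiv in *. lra. }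
  assert (HA2 : 0 <= A2).
  { destruct (HK (rho / 2) ltac:(lra)) as [_ [H _]]. lra. }
  assert (HG0 : forall r, 0 < r < rho -> G r <= 0).
  { intros r Hr. apply Rnot_lt_le. intros HGr.
    set (D := M rho + A2 * Rpower d q / q).
    assert (HD : 0 < D).
    { assert (0 < M rho) by (apply Hu; lra). assert (Hdq := Rpower_gt0 d q).
      assert (0 <= A2 * Rpower d q / q) by (apply Rdiv_le_0_compat; nra).
      unfold D. lra. }
    set (eps := Rmin (Rmin r e) (G r / D)).
    assert (Heps : 0 < eps).
    { repeat apply Rmin_pos; try lra. now apply Rdiv_lt_0_compat. }
    assert (Heps1 : eps <= r /\ eps <= e /\ eps * D <= G r).
    { assert (H1 := Rmin_l (Rmin r e) (G r / D)). assert (H2 := Rmin_r (Rmin r e) (G r / D)).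
      assert (H3 := Rmin_l r e). assert (H4 := Rmin_r r e). fold eps in H1, H2.
      apply (Rmult_le_compat_r D) in H2; [|lra].
      replace (G r / D * D) with (G r) in H2 by (field; lra). lra. }
    destruct (Hx eps Heps) as [x [Hx1 Hx2]].
    assert (HGx : G r <= G x).
    { apply (derive_nonpos_le G G'); [lra| |].
      - intros t Ht. apply HG. lra.
      - intros t Ht. apply HG'. lra. }
    destruct (Hu x ltac:(lra)) as [H1 [H2 _]]. destruct (HM x ltac:(lra)) as [H3 _].
    destruct (HK x ltac:(lra)) as [_ [H5 _]].
    assert (Es : Rpower x (- s) = x * Rpower x (- s - 1)).
    { rewrite <- (Rpower_1 x) at 2 by lra. rewrite <- Rpower_plus. f_equal. ring. }
    (* The power term is (p-1)/p times M x times x |u' x|. *)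
    assert (T1 : (p - 1) / p * (Rpower (M x) (p / (p - 1)) * Rpower x (- s)) < M rho * eps).
    { rewrite EM, Es by lra.
      replace (M x * Rpower (M x) a * (x * Rpower x (- s - 1)))
        with (M x * (x * (Rpower (M x) a * Rpower x (- s - 1)))) by ring.
      set (y := x * (Rpower (M x) a * Rpower x (- s - 1))) in *.
      assert (Hy : 0 < y).
      { unfold y. assert (Z := Rmult_lt_0_compat _ _ (Rpower_gt0 (M x) a) (Rpower_gt0 x (- s - 1))).
        nra. }
      assert ((p - 1) / p <= 1).
      { apply (Rmult_le_reg_r p); [lra|]. replace ((p - 1) / p * p) with (p - 1) by (field; lra). lra. }
      assert (0 < M x * y) by nra.
      apply Rle_lt_trans with (M x * y); nra. }
    assert (T2 : Rpower x m * K x * Rpower (u x) q / q <= eps * (A2 * Rpower d q / q)).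
    (* Since m > 1 and x < 1, x^m <= x < eps. *)
    { assert (Y1 : Rpower x m <= eps).
      { apply Rle_trans with x; [|lra]. rewrite <- (Rpower_1 x) at 2 by lra.
        unfold Rpower. assert (Hln : ln x <= 0) by (rewrite <- ln_1; apply ln_le; lra).
        assert (Hle : m * ln x <= 1 * ln x) by nra.
        destruct Hle as [Hle| ->]; [left; now apply exp_increasing|right; reflexivity]. }
      assert (Y2 : Rpower (u x) q <= Rpower d q).
      { apply Rle_Rpower_l; [lra|split; [assumption|apply Hd; lra]]. }
      assert (Y3 := Rpower_gt0 x m). assert (Y4 := Rpower_gt0 (u x) q).
      unfold Rdiv. rewrite <- !Rmult_assoc.
      apply Rmult_le_compat_r; [left; now apply Rinv_0_lt_compat|].
      apply Rmult_le_compat; [nra|lra| |assumption].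
      apply Rmult_le_compat; lra. }
    assert (T3 : 0 <= (m - p) / p * (u x * M x)).
    { apply Rmult_le_pos; [apply Rdiv_le_0_compat; lra|nra]. }
    assert (T4 : 0 <= c * N * M x) by (apply Rmult_le_pos; nra).
    unfold G at 2 in HGx. unfold D in Heps1. lra. }
  (* G <= 0 is divided by M r after dropping the nonnegative term in K u^q; the remaining inequality
     passes to the limit as r increases to rho. *)
  assert (Hlim : (p - 1) / p * (Rpower (M rho) a * Rpower rho (- s)) - (m - p) / p * u rho <= c * N).
  { apply (continuous_left_le
      (fun r => (p - 1) / p * (Rpower (M r) a * Rpower r (- s)) - (m - p) / p * u r)); [lra| |].
    - apply (ex_derive_continuous (V := R_NormedModule)).
      destruct (Hu rho ltac:(lra)) as [H1 [_ H2]].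
      apply (ex_derive_minus (V := R_NormedModule)
        (fun r => (p - 1) / p * (Rpower (M r) a * Rpower r (- s)))).
      + apply (ex_derive_scal (fun r => Rpower (M r) a * Rpower r (- s))).
        apply (ex_derive_mult (fun r => Rpower (M r) a)).
        * destruct HMR as [l Hl]. eexists. now apply is_derive_Rpower; [|exact Hl].
        * eexists. apply (is_derive_Rpower (fun t => t)); [lra|apply is_derive_id].
      + apply ex_derive_scal. eexists. exact H2.
    - intros r Hr. assert (H := HG0 r Hr). unfold G in H. rewrite EM in H by lra.
      destruct (Hu r ltac:(lra)) as [H1 _]. destruct (HK r Hr) as [_ [H5 _]].
      assert (0 <= Rpower r m * K r * Rpower (u r) q / q).
      { apply Rdiv_le_0_compat; [|assumption].
        apply Rmult_le_pos; [apply Rmult_le_pos|]; try lra; left; apply Rpower_gt0. }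
      apply (Rmult_le_reg_l (M r)); [assumption|]. lra. }
  rewrite HuR in Hlim. fold N in Hlim.
  apply (Rmult_le_reg_l (N * ((p - 1) / p))).
  { apply Rmult_lt_0_compat; [assumption|apply Rdiv_lt_0_compat; lra]. }
  replace (N * ((p - 1) / p) * (c * (p / (p - 1)))) with (c * N) by (field; lra).
  lra.
Qed.

(** * The coefficient [K] near 0 *)

(** Near 0 the hypothesis on [h], used with tolerance [B], gives |h| + r |h'| < B r^ell. So [h]
    cannot outweigh B r^ell, which keeps K above A, and r h' adds at most B r^ell to the main term B
    ell r^ell of r K'. *)
Lemma coefficient_bounds (K h : R -> R) (A B ell : R) :
  C1_halfline K -> 0 < A -> 0 < B -> 0 < ell ->
  (forall r, 0 <= r -> K r = A + B * pow0 r ell + h r) ->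
  filterlim (fun r => (Rabs (h r) + r * Rabs (Derive h r)) / pow0 r ell)
          (at_right 0) (locally 0) ->
  exists (dK : R -> R) (r1 : R), 0 < r1 <= 1 /\ forall r, 0 < r < r1 ->
    is_derive K r (dK r) /\ A <= K r <= A + 2 * B /\
    r * dK r <= B * (ell + 1) * Rpower r ell.
Proof.
  intros [dK HdK] HA HB Hell HK Hh.
  destruct (filterlim_at_right_0 _ _ B Hh HB) as [e [He Hb]].
  exists dK, (Rmin e 1). split.
  { split; [apply Rmin_pos; lra|apply Rmin_r]. }
  intros r [Hr Hr1]. apply Rmin_Rgt in Hr1. destruct Hr1 as [Hre Hr1].
  assert (E0 : forall t, 0 < t -> pow0 t ell = Rpower t ell).
  { intros t Ht. unfold pow0. destruct (Req_EM_T t 0); [lra|reflexivity]. }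
  (* For r > 0, increments smaller than r stay in the half-line, so the one-sided derivative is
     two-sided. *)
  assert (DK : is_derive K r (dK r)).
  { apply is_derive_Reals. intros eps Heps.
    destruct (HdK r (Rlt_le _ _ Hr)) as [HD _].
    destruct (HD eps Heps) as [al [Hal HD']].
    assert (Hdel : 0 < Rmin al r) by (apply Rmin_pos; lra).
    exists (mkposreal _ Hdel). intros t Ht Htd. simpl in Htd.
    assert (Ht1 := Rmin_l al r). assert (Ht2 := Rmin_r al r).
    specialize (HD' (r + t)). unfold D_x in HD'. simpl in HD'. unfold Rdist in HD'.
    replace (r + t - r) with t in HD' by ring. apply HD'.
    assert (Htd' := Rabs_def2 _ _ Htd). repeat split; lra. }
  assert (DP : is_derive (fun t => Rpower t ell) r (ell * Rpower r (ell - 1))).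
  { evar_last.
    - apply (is_derive_Rpower (fun t => t) ell r 1 Hr (is_derive_id r)).
    - exact (Rmult_1_r _). }
  (* [h] inherits differentiability from [K], so [Derive h r] in the limit hypothesis is a true
     derivative and not a default value. *)
  assert (Dh : is_derive h r (dK r - B * (ell * Rpower r (ell - 1)))).
  { apply (is_derive_ext_loc (fun t => (K t - A) - B * Rpower t ell)).
    - exists (mkposreal r Hr). intros t Ht.
      unfold ball in Ht; simpl in Ht.
      unfold AbsRing_ball, abs, minus, plus, opp in Ht; simpl in Ht.
      apply Rabs_def2 in Ht. rewrite HK, E0 by lra. apply Rminus_diag_uniq. ring.
    - apply (is_derive_minus (V := R_NormedModule) (fun t => K t - A)).
      + evar_last.
        * apply (is_derive_minus (V := R_NormedModule) K (fun _ => A)); [exact DK|apply (is_derive_const A)].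
        * unfold minus, plus, opp, zero; simpl. ring.
      + now apply (is_derive_scal (fun t => Rpower t ell)). }
  specialize (Hb r ltac:(lra)). cbv beta in Hb. rewrite E0, Rminus_0_r in Hb by assumption.
  rewrite (is_derive_unique _ _ _ Dh) in Hb.
  set (w := Rpower r ell) in *. assert (Hw : 0 < w) by apply Rpower_gt0.
  assert (Hw1 : w <= 1).
  { unfold w. replace 1 with (Rpower 1 ell) by (unfold Rpower; now rewrite ln_1, Rmult_0_r, exp_0).
    apply Rle_Rpower_l; lra. }
  assert (Ew : r * Rpower r (ell - 1) = w).
  { unfold w. rewrite <- (Rpower_1 r) at 1 by assumption. rewrite <- Rpower_plus. f_equal. ring. }
  set (g := dK r - B * (ell * Rpower r (ell - 1))) in *.
  assert (Hb' : Rabs (h r) + r * Rabs g < B * w).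
  { apply Rabs_def2 in Hb. destruct Hb as [Hb _].
    apply (Rmult_lt_compat_r w) in Hb; [|assumption].
    replace ((Rabs (h r) + r * Rabs g) / w * w) with (Rabs (h r) + r * Rabs g) in Hb by (field; lra).
    exact Hb. }
  assert (P1 := Rabs_pos (h r)). assert (P2 := Rabs_pos g).
  assert (P3 := Rle_abs (h r)). assert (P4 := Rle_abs (- h r)). rewrite Rabs_Ropp in P4.
  assert (P5 := Rle_abs g).
  split; [exact DK|]. rewrite HK, E0 by lra. fold w. split.
  - assert (0 <= r * Rabs g) by nra. nra.
  - assert (r * g <= r * Rabs g) by nra.
    replace (r * dK r) with (r * g + B * ell * (r * Rpower r (ell - 1))) by (unfold g; ring).
    rewrite Ew. lra.
Qed.

(** * Lower bound for the first zero, uniform in the initial value *)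

Theorem proposition44
  (n : nat) (p q : R) (K : R -> R) (u : R -> R -> R)
  (A B ell : R) (h : R -> R)
  (hn : (0 < n)%nat)
  (hp : 1 < p < INR n)
  (hp2 : 2 * INR n / (INR n + 2) <= p <= 2)
  (hq : q = INR n * p / (INR n - p))
  (hKpos : forall r, 0 <= r -> 0 < K r)
  (hKC1 : C1_halfline K)
  (hu : forall d, 0 < d -> regular_solution n p q K d (u d))
  (hA : 0 < A) (hB : 0 < B) (hell : 0 < ell)
  (hK : forall r, 0 <= r -> K r = A + B * pow0 r ell + h r)
  (hh : filterlim (fun r => (Rabs (h r) + r * Rabs (Derive h r)) / pow0 r ell)
          (at_right 0) (locally 0))
  (hcrit : (INR n - p) / (p - 1) <= ell) :
  exists R0 : R, 0 < R0 /\
    forall d, 0 <= d -> Rbar_le (Finite R0) (Rtilde u d).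

Proof.
  assert (Hp : 1 < p) by lra. set (m := INR n) in *.
  set (s := (m - p) / (p - 1)) in *.
  assert (Hs : 0 < s) by (apply Rdiv_lt_0_compat; lra).
  assert (Hq : 0 < q) by (rewrite hq; apply Rdiv_lt_0_compat; nra).
  destruct (coefficient_bounds K h A B ell hKC1 hA hB hell hK hh) as [dK [r1 [Hr1 HK]]].
  set (C := B * (ell + 1)). assert (HC : 0 < C) by (unfold C; nra).
  (* [b] bounds rho^(-s) for any zero rho < r1 and does not involve [d]; below [r2] one has rho^s <
     1 / b, the opposite inequality. *)
  set (b := C / (q * s * A) * (p / (p - 1))).
  assert (Hb : 0 < b).
  { repeat (apply Rdiv_lt_0_compat || apply Rmult_lt_0_compat); lra. }
  destruct (small_Rpower s (/ b) Hs (Rinv_0_lt_compat _ Hb)) as [r2 [Hr2 Hsmall]].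
  exists (Rmin r1 r2). split; [apply Rmin_pos; lra|].
  intros d _. unfold Rtilde. destruct (excluded_middle_informative (J u d)) as [HJ|]; [|exact I].
  destruct HJ as [Hd Hz]. destruct (hu d Hd) as [Hsol Hlim].
  set (U := u d) in *.
  assert (Hcont : forall r, 0 < r -> continuous U r).
  { intros r Hr. apply (ex_derive_continuous (V := R_NormedModule)), Hsol, Hr. }
  assert (Hfz : is_first_zero U (first_zero U)).
  { unfold first_zero. apply epsilon_spec. now apply (exists_first_zero U d). }
  set (rho := first_zero U) in *. simpl.
  apply Rnot_lt_le. intros Hlt. apply Rmin_Rgt in Hlt. destruct Hlt as [Hlt1 Hlt2].
  assert (Hpos := fun r => pos_before_first_zero U d rho r Hd Hcont Hlim Hfz).
  destruct Hfz as [Hrho [HU0 _]].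
  set (M := fun r => - flux n p U r).
  assert (HM : forall r, 0 < r -> is_derive M r (r ^ (n - 1) * K r * spow q (U r))).
  { intros r Hr. destruct (Hsol r Hr) as [_ [H1 H2]].
    evar_last; [apply (is_derive_opp (V := R_NormedModule)), Derive_correct, H1|].
    unfold opp; simpl. lra. }
  assert (HM' : forall r, 0 < r < rho ->
    is_derive M r (Rpower r (m - 1) * K r * Rpower (U r) (q - 1))).
  { intros r Hr. unfold m. rewrite <- pow_minus_1_Rpower, <- spow_pos by (lia || lra || auto).
    apply HM. lra. }
  assert (Hinc : forall r t, 0 < r -> r < t <= rho -> M r < M t).
  { intros r t Hr Ht.
    apply (derive_pos_lt M (fun r => r ^ (n - 1) * K r * spow q (U r))); [lra| |].
    - intros c Hc. apply HM. lra.
    - intros c Hc. rewrite spow_pos by (apply Hpos; lra).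
      repeat apply Rmult_lt_0_compat; [apply pow_lt; lra|apply hKpos; lra|apply Rpower_gt0]. }
  assert (Hseq := fun eps => small_scaled_derivative U d eps
    (fun r Hr => proj1 (Hsol r Hr)) Hlim).
  assert (HMpos : forall r, 0 < r <= rho -> 0 < M r).
  { intros r Hr. apply Rle_lt_trans with (M (r / 2)); [|apply Hinc; lra].
    apply Rnot_lt_le. intros Hneg.
    destruct (small_Rpower (m - p) (- M (r / 2)) ltac:(lra) ltac:(lra)) as [e [He Hsm]].
    destruct (Hseq (Rmin (Rmin e 1) (r / 2))) as [x [Hx1 Hx2]].
    { repeat apply Rmin_pos; lra. }
    destruct Hx1 as [Hx0 Hx1]. apply Rmin_Rgt in Hx1. destruct Hx1 as [Hx1 Hx4].
    apply Rmin_Rgt in Hx1. destruct Hx1 as [Hx1 Hx3].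
    assert (H1 := Rmin_l (Rmin e 1) (r / 2)). assert (H2 := Rmin_r e 1).
    assert (H3 := Rabs_flux_le n p U x hn Hp Hx0 ltac:(lra)). fold m in H3.
    assert (H4 := Hsm x ltac:(lra)). assert (H5 := Hinc x (r / 2) Hx0 ltac:(lra)).
    assert (H6 := Rle_abs (flux n p U x)). unfold M in *. lra. }
  assert (HDU : forall r, 0 < r <= rho ->
    Derive U r = - (Rpower (M r) (/ (p - 1)) * Rpower r (- s - 1))).
  { intros r Hr. apply Derive_of_neg_flux; [assumption|assumption|lra|].
    assert (H := HMpos r Hr). unfold M in H. lra. }
  assert (Hbound : Rpower rho (- s) <= b).
  { apply (zero_radius_bound m p q s A (A + 2 * B) C rho (d + 1) K dK U M);
      try assumption; try reflexivity; try lra.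
    - intros r Hr. destruct (HK r ltac:(lra)) as [H1 [H2 H3]].
      split; [exact H1|split; [exact H2|]]. apply Rle_trans with (1 := H3).
      apply Rmult_le_compat_l; [lra|].
      (* Criticality enters here: r < 1 and ell >= s give r^ell <= r^s. *)
      unfold Rpower. assert (Hln : ln r <= 0) by (rewrite <- ln_1; apply ln_le; lra).
      assert (Hle : ell * ln r <= s * ln r) by nra.
      destruct Hle as [Hle| ->]; [left; now apply exp_increasing|right; reflexivity].
    - intros r Hr. split; [now apply HMpos|split].
      + destruct (Req_dec r rho) as [-> |]; [lra|left; apply Hinc; lra].
      + rewrite <- HDU by assumption. apply Derive_correct, Hsol. lra.
    - intros r Hr. split; [now apply Hpos|now apply HM'].
    - eexists. now apply HM.
    - destruct (filterlim_at_right_0 U d 1 Hlim ltac:(lra)) as [e [He Hne]].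
      exists e. split; [assumption|]. intros r Hr. specialize (Hne r Hr).
      apply Rabs_def2 in Hne. lra.
    - intros eps Heps. destruct (Hseq (Rmin eps rho)) as [x [Hx1 Hx2]].
      { now apply Rmin_pos. }
      destruct Hx1 as [Hx0 Hx1]. apply Rmin_Rgt in Hx1.
      assert (H1 := Rmin_l eps rho).
      exists x. split; [lra|]. rewrite HDU, Rabs_Ropp in Hx2 by lra.
      rewrite Rabs_pos_eq in Hx2; [lra|].
      apply Rmult_le_pos; left; apply Rpower_gt0. }
  assert (H1 := Hsmall rho ltac:(lra)).
  rewrite Rpower_Ropp in Hbound.
  assert (H2 := Rpower_gt0 rho s).
  apply Rinv_lt_contravar in H1; [rewrite Rinv_inv in H1; lra|].
  apply Rmult_lt_0_compat; [assumption|now apply Rinv_0_lt_compat].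
Qed.
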